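(* Let $E/\mathbb{Q}$ be an elliptic curve, given by a minimal Weierstrass model, and let $E_n$ be the minimal model of its twist by a square-free positive integer $n$. Then there is a computable non-zero rational number $\alpha_n$ such that $$\Omega(E_n)=\frac{\alpha_n\,\Omega(E)}{\sqrt{n}}.$$
   Context: For an elliptic curve given by a Weierstrass model $y^2+a_1xy+a_3y=x^3+a_2x^2+a_4x+a_6$ over $\mathbb{Q}$ with invariant differential $\omega=dx/(2y+a_1x+a_3)$, the period is $\Omega(E)=\int_{E(\mathbb{R})}|\omega|$. The twist by $n$ is the quadratic twist of $E$ by $\mathbb{Q}(\sqrt n)$. $\Omega(E_n)$ is the period of the minimal model $E_n$. *)

(* Defs.v *)
From HB Require Import structures.
From mathcomp Require Import all_boot all_order all_algebra.
From mathcomp Require Import all_classical all_reals all_analysis.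

Set Implicit Arguments.
Unset Strict Implicit.
Unset Printing Implicit Defensive.

Import Order.TTheory GRing.Theory Num.Theory.
Import numFieldNormedType.Exports.

Local Open Scope ring_scope.

(* y^2 + a1 x y + a3 y = x^3 + a2 x^2 + a4 x + a6 *)
Record weierstrass (K : Type) := Weierstrass { a1 : K; a2 : K; a3 : K; a4 : K; a6 : K }.

Definition map_weierstrass (K L : Type) (f : K -> L) (W : weierstrass K) : weierstrass L :=
  Weierstrass (f (a1 W)) (f (a2 W)) (f (a3 W)) (f (a4 W)) (f (a6 W)).

Section Invariants.
Variables (K : comNzRingType) (W : weierstrass K).

Definition b2 : K := a1 W ^+ 2 + 4 * a2 W.
Definition b4 : K := 2 * a4 W + a1 W * a3 W.
Definition b6 : K := a3 W ^+ 2 + 4 * a6 W.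
Definition b8 : K :=
  a1 W ^+ 2 * a6 W + 4 * a2 W * a6 W - a1 W * a3 W * a4 W
  + a2 W * a3 W ^+ 2 - a4 W ^+ 2.
Definition disc : K :=
  - b2 ^+ 2 * b8 - 8 * b4 ^+ 3 - 27 * b6 ^+ 2 + 9 * b2 * b4 * b6.

Definition elliptic : Prop := disc != 0.

Definition affine_points : set (K * K) :=
  [set p | p.2 ^+ 2 + a1 W * p.1 * p.2 + a3 W * p.2
           = p.1 ^+ 3 + a2 W * p.1 ^+ 2 + a4 W * p.1 + a6 W].

End Invariants.

(* The model obtained from W by the substitution
   x = u^2 x' + r,  y = u^3 y' + u^2 s x' + t. *)
Definition change_coords (K : fieldType) (u r s t : K) (W : weierstrass K) : weierstrass K :=
  Weierstrass
    ((a1 W + 2 * s) / u)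
    ((a2 W - s * a1 W + 3 * r - s ^+ 2) / u ^+ 2)
    ((a3 W + r * a1 W + 2 * t) / u ^+ 3)
    ((a4 W - s * a3 W + 2 * r * a2 W - (t + r * s) * a1 W
      + 3 * r ^+ 2 - 2 * s * t) / u ^+ 4)
    ((a6 W + r * a4 W + r ^+ 2 * a2 W + r ^+ 3 - t * a3 W - t ^+ 2
      - r * t * a1 W) / u ^+ 6).

Definition isomorphic (K : fieldType) (W W' : weierstrass K) : Prop :=
  exists u r s t : K, u != 0 /\ W' = change_coords u r s t W.

Definition to_rat : weierstrass int -> weierstrass rat := map_weierstrass intr.

(* M is a (global) minimal model of W: among the integral Weierstrass equations
   of the Q-isomorphism class of W, its discriminant is least in absolute value. *)
Definition minimal_model_of (W : weierstrass rat) (M : weierstrass int) : Prop :=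
  isomorphic W (to_rat M) /\
  forall M' : weierstrass int, isomorphic W (to_rat M') -> `|disc M| <= `|disc M'|.

Definition minimal (M : weierstrass int) : Prop := minimal_model_of (to_rat M) M.

(* With eta = 2 y + a1 x + a3, the curve W is eta^2 = 4 x^3 + b2 x^2 + 2 b4 x + b6,
   and its quadratic twist by Q(sqrt d) is d eta^2 = 4 x^3 + b2 x^2 + 2 b4 x + b6;
   the model below is in the coordinates X = d x, Y = d^2 eta / 2. *)
Definition quadratic_twist (d : rat) (W : weierstrass rat) : weierstrass rat :=
  Weierstrass 0 (d * b2 W / 4) 0 (d ^+ 2 * b4 W / 2) (d ^+ 3 * b6 W / 4).

Definition square_free (n : nat) : Prop :=
  forall p : nat, prime p -> ~~ (p ^ 2 %| n)%N.

(* The integral of g |dx| over the curve C: the first coordinate x is a local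
   coordinate on C, so one integrates over x the sum of g over the points of C
   above x. *)
Definition integral_abs_dx (R : realType) (C : set (R * R)) (g : R * R -> \bar R) : \bar R :=
  (\int[@lebesgue_measure R]_x \esum_(y in [set y | C (x, y)]) g (x, y))%E.

(* The integral of |omega|, omega = dx / (2 y + a1 x + a3), over the real points of
   W. The point at infinity and the at most three points with 2 y + a1 x + a3 = 0
   (where 0^-1 = 0 and x is not a local coordinate) form a null set. *)
Definition period (R : realType) (W : weierstrass int) : \bar R :=
  let WR : weierstrass R := map_weierstrass intr W in
  integral_abs_dx (affine_points WR)
    (fun p => (`|2 * p.2 + a1 WR * p.1 + a3 WR|^-1)%:E).

(* The total recursive functions: the least class containing zero, successor and
   the projections and closed under composition, primitive recursion and
   minimization of functions that have a zero for every value of the parameters. *)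
Inductive recursive : forall k : nat, (k.-tuple nat -> nat) -> Prop :=
| recursive_zero : recursive (fun _ : 0.-tuple nat => 0%N)
| recursive_succ : recursive (fun v : 1.-tuple nat => (thead v).+1)
| recursive_proj (k : nat) (i : 'I_k) :
    recursive (fun v : k.-tuple nat => tnth v i)
| recursive_comp (k m : nat) (f : m.-tuple nat -> nat)
    (g : 'I_m -> k.-tuple nat -> nat) :
    recursive f -> (forall i, recursive (g i)) ->
    recursive (fun v : k.-tuple nat => f [tuple g i v | i < m])
| recursive_primrec (k : nat) (f : k.-tuple nat -> nat) (g : k.+2.-tuple nat -> nat)
    (h : k.+1.-tuple nat -> nat) :
    recursive f -> recursive g ->
    (forall v : k.-tuple nat, h [tuple of 0%N :: v] = f v) ->
    (forall (m : nat) (v : k.-tuple nat),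
       h [tuple of m.+1 :: v] = g [tuple of m :: h [tuple of m :: v] :: v]) ->
    recursive h
| recursive_min (k : nat) (g : k.+1.-tuple nat -> nat) (h : k.-tuple nat -> nat) :
    recursive g ->
    (forall v : k.-tuple nat, g [tuple of h v :: v] = 0%N) ->
    (forall (v : k.-tuple nat) (m : nat), (m < h v)%N -> g [tuple of m :: v] <> 0%N) ->
    recursive h.

(* The bijection 0, 1, 2, 3, 4, ... |-> 0, -1, 1, -2, 2, ... *)
Definition int_decode (m : nat) : int := if odd m then Negz m./2 else Posz m./2.

Definition computable (alpha : weierstrass int -> nat -> rat) : Prop :=
  exists num den : 6.-tuple nat -> nat,
    [/\ recursive num, recursive den &
      forall c1 c2 c3 c4 c6 n : nat,
        let W := Weierstrass (int_decode c1) (int_decode c2) (int_decode c3)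
                             (int_decode c4) (int_decode c6) in
        let v := [tuple c1; c2; c3; c4; c6; n] in
        alpha W n = (int_decode (num v))%:~R / (den v)%:R].

(* Main.v *)
Require Import Defs.
From mathcomp Require Import all_boot all_order all_algebra.
From mathcomp Require Import all_classical all_reals all_analysis.
From mathcomp Require Import measurable_realfun ring lra zify.

(** Why the theorem holds.

The substitution x = u^2 x' + r, y = u^3 y' + u^2 s x' + t turns the invariant
differential omega into omega' = u omega, so it multiplies the period by |u|
(real_period_change_coords).  Over the real numbers the twist of E by n is
obtained from E by such a substitution with u = 1 / sqrt n
(quadratic_twist_real), and the minimal model En is obtained from the twist by
one with a rational u.  Hence the period of En is |u| / sqrt n times that of E,
and alpha = |u|.

To see that real_period_change_coords holds, integrate |omega| over the two
points above x: with g = 4 x^3 + b2 x^2 + 2 b4 x + b6 each of them contributes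
1 / sqrt g when g > 0, so the period is the integral of 2 / sqrt g
(real_periodE), where 1 / sqrt g reads as 0 when g <= 0.  The substitution
replaces g by g (u^2 x + r) / u^6, and the statement becomes an affine change of
variable in a Lebesgue integral.

It remains to compute |u| from E and n.  Comparing discriminants,
|u|^12 |disc En| = n^6 |disc E|, so it is enough to compute D = |disc En|: then
k = |u| D satisfies k^12 = n^6 |disc E| D^11, hence is an integer, and
|u| = k / D.  By minimality D is the least absolute discriminant of an integral
model of the twist, and the integer k attached to a candidate D turns the
existence of such a model into a finite question:
- over a field of characteristic 0, two models with c4 = u^4 c4' and
  c6 = u^6 c6' differ by a change of coordinates with that u
  (change_coords_of_c4_c6), so a model M is recognised by the integral equations
  n^2 D^4 c4(E) = k^4 c4(M) and n^3 D^6 c6(E) = k^6 c6(M);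
- an integral substitution with u = 1 reduces a1, a2, a3 to {-1, 0, 1} (reduced_model), after
  which c4 and c6 bound a4 and a6 (reduced_model_bound).
The candidates D themselves are bounded by 2^12 n^6 |disc E|, the discriminant of
an explicit integral model of the twist (integral_twist_model).  So D and k are
found by nested bounded searches over polynomial equations (twist_factor), and
such searches are recursive (recursive_find, recursive_has). *)

Set Implicit Arguments.
Unset Strict Implicit.
Unset Printing Implicit Defensive.

Import Order.TTheory GRing.Theory Num.Theory.
Import numFieldNormedType.Exports.

Local Open Scope classical_set_scope.
Local Open Scope ring_scope.

(** * Affine changes of variable in Lebesgue integrals *)

Lemma measurable_affine (R : realType) (c r : R) :
  measurable_fun setT (fun x : measurableTypeR R => c * x + r : measurableTypeR R).
Proof. by apply: measurable_funD => //; apply: measurable_funM. Qed.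

(** The scaling by c makes up for the contraction of lengths under preimage by
    x |-> c x + r, so that this measure is Lebesgue measure again. *)
Definition scaled_affine_image (R : realType) (c : {nonneg R}) (r : R) :
  {measure set (measurableTypeR R) -> \bar R}.
Proof.
refine (mscale c (pushforward (@lebesgue_measure R)
  (fun x : measurableTypeR R => c%:num * x + r : measurableTypeR R))).
exact: measurable_affine.
Defined.

(** Lebesgue measure is determined by its values on the intervals ]a, b], whose
    preimages are the intervals ](a - r) / c, (b - r) / c]. *)
Lemma lebesgue_measure_affine (R : realType) (c : {nonneg R}) (r : R)
    (A : set (measurableTypeR R)) :
  0 < c%:num -> measurable A ->
  lebesgue_measure A = scaled_affine_image c r A.
Proof.
move=> c0 mA; apply: lebesgue_measure_unique mA => X [[a b] /= _ <-].
rewrite /mscale /= /pushforward.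
rewrite (_ : _ @^-1` _ = `](a - r) / c%:num, (b - r) / c%:num]%classic); last first.
  apply/seteqP; split => x /=; rewrite !in_itv /=;
  by rewrite ltr_pdivrMr // ler_pdivlMr // ltrBlDr lerBrDr (mulrC x).
rewrite [LHS]lebesgue_measure_itv lebesgue_measure_itv /= !lte_fin.
rewrite ltr_pM2r ?invr_gt0 // ltrD2r; case: ifP => _; last by rewrite mule0.
rewrite -!EFinB -EFinM; congr (_%:E).
by field; rewrite gt_eqF.
Qed.

Lemma integral_affine (R : realType) (c r : R) (f : R -> \bar R) :
  0 < c -> measurable_fun [set: measurableTypeR R] f -> (forall x, 0 <= f x)%E ->
  (\int[@lebesgue_measure R]_x f x =
   c%:E * \int[@lebesgue_measure R]_x f (c * x + r)%R)%E.
Proof.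
move=> c0 mf f0; pose cn : {nonneg R} := NngNum (ltW c0).
rewrite (eq_measure_integral (scaled_affine_image cn r)).
  rewrite ge0_integral_mscale //.
  by rewrite (ge0_integral_pushforward (measurable_affine c r)).
by move=> A mA _; apply: (@lebesgue_measure_affine R cn).
Qed.

(** * The period of a real Weierstrass curve *)

(** The square of 2 y + a1 x + a3 on the curve; its roots are the abscissas of the
    points of order 2. *)
Definition two_division (K : comNzRingType) (W : weierstrass K) (x : K) : K :=
  4 * x ^+ 3 + b2 W * x ^+ 2 + 2 * b4 W * x + b6 W.

Lemma measurable_invr_sqrt (R : realType) :
  measurable_fun setT (fun x : R => (Num.sqrt x)^-1).
Proof.
under eq_fun do rewrite -(powR_inv1 (sqrtr_ge0 _)).
apply: (measurableT_comp (measurable_powR _)).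
apply: continuous_measurable_fun; exact: sqrt_continuous.
Qed.

(** Completing the square, the points above x are the solutions of
    (2 y + a1 x + a3)^2 = g.  For g = 0 the only point has the weight 0^-1 = 0, and
    for g < 0 there is none; both cases agree with the right-hand side because
    Num.sqrt g = 0 for g <= 0. *)
Lemma fiber_integral (R : realType) (W : weierstrass R) (x : R) :
  (\esum_(y in [set y | affine_points W (x, y)])
     (`|2 * y + a1 W * x + a3 W|^-1)%:E
   = (2 * (Num.sqrt (two_division W x))^-1)%:E)%E.
Proof.
set g := two_division W x; set h := a1 W * x + a3 W.
have Cg y : affine_points W (x, y) <-> (2 * y + h) ^+ 2 = g.
  rewrite /affine_points /= /g /two_division /h /b2 /b4 /b6.
  split => H; first by lra.
  by lra.
have [g0|g0] := leP g 0.
  rewrite ler0_sqrtr // invr0 mulr0; apply: esum1 => y /= /Cg yg.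
  have : 2 * y + h = 0.
    by apply/eqP; rewrite -sqrf_eq0 eq_le sqr_ge0 yg g0.
  by rewrite /h addrA => ->; rewrite normr0 invr0.
set s := Num.sqrt g.
have s0 : 0 < s by rewrite sqrtr_gt0.
have sg : s ^+ 2 = g by rewrite sqr_sqrtr // ltW.
have -> : [set y | affine_points W (x, y)] =
    [set (s - h) / 2] `|` [set (- s - h) / 2].
  apply/seteqP; split => y /=.
    move/Cg => /eqP; rewrite -sg eqf_sqr => /orP[] /eqP E; [left|right]; lra.
  by case=> ->; apply/Cg; rewrite -sg; field.
rewrite (esumID [set (s - h) / 2]); last by move=> *; rewrite lee_fin invr_ge0.
rewrite setIUl setIid (_ : _ `&` _ = set0) ?setU0; last first.
  by apply/seteqP; split => y //= [-> /eqP]; rewrite eq_sym; apply/negP/eqP => ?; lra.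
rewrite setIUl setICr set0U (_ : _ `&` _ = [set (- s - h) / 2]); last first.
  apply/seteqP; split => y /=; first by case.
  by move=> ->; split => // ?; lra.
rewrite !esum_set1 ?lee_fin ?invr_ge0 //.
rewrite -!addrA -/h -EFinD; congr (_%:E).
have -> : 2 * ((s - h) / 2) + h = s by field.
have -> : 2 * ((- s - h) / 2) + h = - s by field.
by rewrite normrN gtr0_norm // mulr_natl mulr2n.
Qed.

(** The period for arbitrary real coefficients: the change of coordinates that leads
    to the twist is not rational. *)
Definition real_period (R : realType) (W : weierstrass R) : \bar R :=
  integral_abs_dx (affine_points W)
    (fun p => (`|2 * p.2 + a1 W * p.1 + a3 W|^-1)%:E).

Lemma real_periodE (R : realType) (W : weierstrass R) :
  real_period W =
  (\int[@lebesgue_measure R]_x (2 * (Num.sqrt (two_division W x))^-1)%:E)%E.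
Proof. by apply: eq_integral => x _; rewrite fiber_integral. Qed.

Lemma two_division_change_coords (K : fieldType) (u r s t x : K) (W : weierstrass K) :
  u != 0 ->
  two_division (change_coords u r s t W) x = two_division W (u ^+ 2 * x + r) / u ^+ 6.
Proof.
move=> u0; rewrite /two_division /b2 /b4 /b6 /change_coords /=.
by field.
Qed.

(** The integrand 2 / sqrt g is multiplied by |u|^3, and the change of variable
    x |-> u^2 x + r accounts for the factor u^-2. *)
Lemma real_period_change_coords (R : realType) (u r s t : R) (W : weierstrass R) :
  u != 0 ->
  real_period (change_coords u r s t W) = (`|u|%:E * real_period W)%E.
Proof.
move=> u0; have u2 : 0 < u ^+ 2 by rewrite exprn_even_gt0.
have f0 x : (0 <= (2 * (Num.sqrt (two_division W x))^-1)%:E)%E.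
  by rewrite lee_fin mulr_ge0 // invr_ge0.
have mf : measurable_fun [set: measurableTypeR R]
   (fun x : R => (2 * (Num.sqrt (two_division W x))^-1)%:E).
  apply/measurable_EFinP/measurable_funM => //.
  apply: (measurableT_comp (@measurable_invr_sqrt R)).
  rewrite /two_division; repeat first [apply: measurable_funD => //
    | apply: measurable_funM => // | exact: measurable_funX].
rewrite !real_periodE [in RHS](integral_affine r u2 mf f0) muleA -EFinM.
rewrite -ge0_integralZl //; first last.
- by rewrite lee_fin mulr_ge0 // ltW.
- apply: (measurableT_comp mf); exact: measurable_affine.
apply: eq_integral => x _; rewrite -EFinM two_division_change_coords //.
have -> : u ^+ 6 = (`|u| ^+ 3) ^+ 2.
  by rewrite -exprM -normrX ger0_norm // exprn_even_ge0.
have u3 : 0 < `|u| ^+ 3 by rewrite exprn_gt0 // normr_gt0.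
rewrite [X in Num.sqrt X]mulrC sqrtrM ?invr_ge0 ?sqr_ge0 // -exprVn sqrtr_sqr.
rewrite ger0_norm ?invr_ge0 ?(ltW u3) // invfM invrK.
set q := (Num.sqrt _)^-1; rewrite -(real_normK (num_real u)); congr (_%:E).
by ring.
Qed.

(** * The invariants c4 and c6 *)

Definition c4 (K : comNzRingType) (W : weierstrass K) : K := b2 W ^+ 2 - 24 * b4 W.
Definition c6 (K : comNzRingType) (W : weierstrass K) : K :=
  - b2 W ^+ 3 + 36 * b2 W * b4 W - 216 * b6 W.

Section ChangeOfCoordinates.
Variables (K : fieldType) (u r s t : K) (W : weierstrass K).
Hypothesis u0 : u != 0.
Let W' := change_coords u r s t W.

Lemma c4_change_coords : c4 W' = c4 W / u ^+ 4.
Proof. by rewrite /c4 /b2 /b4 /=; field. Qed.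

Lemma c6_change_coords : c6 W' = c6 W / u ^+ 6.
Proof. by rewrite /c6 /b2 /b4 /b6 /=; field. Qed.

Lemma disc_change_coords : disc W' = disc W / u ^+ 12.
Proof. by rewrite /disc /b2 /b4 /b6 /b8 /=; field. Qed.

End ChangeOfCoordinates.

Lemma a4_c4 (K : comNzRingType) (W : weierstrass K) :
  48 * a4 W = b2 W ^+ 2 - 24 * a1 W * a3 W - c4 W.
Proof. by rewrite /c4 /b4; ring. Qed.

Lemma a6_c6 (K : comNzRingType) (W : weierstrass K) :
  864 * a6 W = 36 * b2 W * b4 W - b2 W ^+ 3 - 216 * a3 W ^+ 2 - c6 W.
Proof. by rewrite /c6 /b6; ring. Qed.

(** The coefficients a1, a2, a3 of W' dictate s, r and t; then a4 and a6 agree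
    because they can be recovered from a1, a2, a3, c4 and c6, as 48 and 864 are
    invertible. *)
Lemma change_coords_of_c4_c6 (K : numFieldType) (u : K) (W W' : weierstrass K) :
  u != 0 -> c4 W = u ^+ 4 * c4 W' -> c6 W = u ^+ 6 * c6 W' ->
  exists r s t, W' = change_coords u r s t W.
Proof.
move=> u0 e4 e6.
pose s := (u * a1 W' - a1 W) / 2.
pose r := (u ^+ 2 * b2 W' - b2 W) / 12.
pose t := (u ^+ 3 * a3 W' - a3 W - r * a1 W) / 2.
exists r, s, t.
have n2 : (2 : K) != 0 by rewrite pnatr_eq0.
have n3 : (3 : K) != 0 by rewrite pnatr_eq0.
have c4' : c4 W' = c4 W / u ^+ 4 by rewrite e4; field.
have c6' : c6 W' = c6 W / u ^+ 6 by rewrite e6; field.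
have e1 : a1 W' = a1 (change_coords u r s t W) by rewrite /= /s; field; rewrite u0.
have e2 : a2 W' = a2 (change_coords u r s t W).
  by rewrite /= /r /s /b2; field; rewrite u0.
have e3 : a3 W' = a3 (change_coords u r s t W) by rewrite /= /t; field; rewrite u0.
rewrite -(c4_change_coords r s t) // in c4'.
rewrite -(c6_change_coords r s t) // in c6'.
have e4' : a4 W' = a4 (change_coords u r s t W).
  apply: (@mulfI _ 48); first by rewrite pnatr_eq0.
  by rewrite !a4_c4 c4' /b2 e1 e2 e3.
have e6' : a6 W' = a6 (change_coords u r s t W).
  apply: (@mulfI _ 864); first by rewrite pnatr_eq0.
  by rewrite !a6_c6 c6' /b2 /b4 e1 e2 e3 e4'.
by move: e1 e2 e3 e4' e6'; case: (W') => ? ? ? ? ? /= -> -> -> -> ->.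
Qed.

Section Twist.
Variables (W : weierstrass rat) (d : rat).

Lemma c4_quadratic_twist : c4 (quadratic_twist d W) = d ^+ 2 * c4 W.
Proof. by rewrite /c4 /quadratic_twist /b2 /b4 /=; field. Qed.

Lemma c6_quadratic_twist : c6 (quadratic_twist d W) = d ^+ 3 * c6 W.
Proof. by rewrite /c6 /quadratic_twist /b2 /b4 /b6 /=; field. Qed.

Lemma disc_quadratic_twist : disc (quadratic_twist d W) = d ^+ 6 * disc W.
Proof. by rewrite /disc /quadratic_twist /b2 /b4 /b6 /b8 /=; field. Qed.

End Twist.

Section Morphism.
Variables (K L : comNzRingType) (f : {rmorphism K -> L}) (W : weierstrass K).

Lemma c4_map : c4 (map_weierstrass f W) = f (c4 W).
Proof. by rewrite /c4 /b2 /b4 /=; ring. Qed.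

Lemma c6_map : c6 (map_weierstrass f W) = f (c6 W).
Proof. by rewrite /c6 /b2 /b4 /b6 /=; ring. Qed.

Lemma disc_map : disc (map_weierstrass f W) = f (disc W).
Proof. by rewrite /disc /b2 /b4 /b6 /b8 /=; ring. Qed.

End Morphism.

(** Substitutions with u = 1 and integral s, r, t shift a1 by 2 s, a2 by 3 r and a3
    by 2 t, up to terms in the parameters chosen before. *)
Lemma reduced_model (M : weierstrass int) :
  exists N : weierstrass int,
    [/\ `|a1 N| <= 1, `|a2 N| <= 1 & `|a3 N| <= 1] /\ (c4 N = c4 M /\ c6 N = c6 M).
Proof.
have div2 (a : int) : exists s, `|a + 2 * s| <= 1.
  by exists (- (a %/ 2)%Z); lia.
have div3 (a : int) : exists s, `|a + 3 * s| <= 1.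
  by exists (- ((a + 1) %/ 3)%Z); lia.
case: M => a b c d e.
have [s hs] := div2 a.
have [r hr] := div3 (b - s * a - s ^+ 2).
have [t ht] := div2 (c + r * a).
exists (Weierstrass (a + 2 * s) (b - s * a + 3 * r - s ^+ 2) (c + r * a + 2 * t)
  (d - s * c + 2 * r * b - (t + r * s) * a + 3 * r ^+ 2 - 2 * s * t)
  (e + r * d + r ^+ 2 * b + r ^+ 3 - t * c - t ^+ 2 - r * t * a)).
split; first by split => //=; rewrite addrAC.
by rewrite /c4 /c6 /b2 /b4 /b6 /=; split; ring.
Qed.

(** The identities a4_c4 and a6_c6 express a4 and a6 through c4, c6 and the bounded
    quantities a1, a2, a3; the constants are crude. *)
Lemma reduced_model_bound (M : weierstrass int) :
  `|a1 M| <= 1 -> `|a2 M| <= 1 -> `|a3 M| <= 1 ->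
  `|a4 M| <= 49 + `|c4 M| /\ `|a6 M| <= 100 + 100 * `|c4 M| + `|c6 M|.
Proof.
have solve4 (a p q c C : int) : 48 * a = p - 24 * q - c ->
    `|p| <= 25 -> `|q| <= 1 -> `|c| <= C -> `|a| <= 49 + C.
  by rewrite !ler_norml; lia.
have solveb (a b q C : int) : b = 2 * a + q -> `|a| <= 49 + C -> `|q| <= 1 ->
    `|b| <= 99 + 2 * C.
  by rewrite !ler_norml; lia.
have solve6 (a p q r c C C4 : int) : 864 * a = 36 * p - q - 216 * r - c -> 0 <= C4 ->
    `|p| <= 5 * (99 + 2 * C4) -> `|q| <= 125 -> `|r| <= 1 -> `|c| <= C ->
    `|a| <= 100 + 100 * C4 + C.
  by rewrite !ler_norml; lia.
have solve2 (p a : int) : `|p| <= 1 -> `|a| <= 1 -> `|p + 4 * a| <= 5.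
  by rewrite !ler_norml; lia.
move=> h1 h2 h3.
have b2_le : `|b2 M| <= 5 by apply: solve2 => //; rewrite normrX exprn_ile1.
have b2_sqr : `|b2 M ^+ 2| <= 25.
  by rewrite normrX (_ : 25 = 5 ^+ 2) // lerXn2r ?nnegrE.
have b2_cub : `|b2 M ^+ 3| <= 125.
  by rewrite normrX (_ : 125 = 5 ^+ 3) // lerXn2r ?nnegrE.
have a13 : `|a1 M * a3 M| <= 1 by rewrite normrM mulr_ile1.
have a4E : 48 * a4 M = b2 M ^+ 2 - 24 * (a1 M * a3 M) - c4 M.
  by rewrite a4_c4 mulrA.
have a6E : 864 * a6 M =
    36 * (b2 M * b4 M) - b2 M ^+ 3 - 216 * a3 M ^+ 2 - c6 M.
  by rewrite a6_c6 mulrA.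
have a4_le := solve4 _ _ _ _ _ a4E b2_sqr a13 (lexx _).
have b4_le := solveb _ (b4 M) _ _ erefl a4_le a13.
split=> //; apply: solve6 a6E _ _ b2_cub _ _ => //; last by rewrite normrX exprn_ile1.
by rewrite normrM ler_pM.
Qed.

(** * The scaling factor of the minimal model, found by bounded search *)

Section Search.
Variables (E : weierstrass int) (n : nat).

(** With u = k / D, the conditions c4 = u^4 c4(M) and c6 = u^6 c6(M) on the invariants
    of the twist of E by n, cleared of denominators. *)
Definition scaled_twist (D k : nat) (M : weierstrass int) : bool :=
  (n%:Z ^+ 2 * D%:Z ^+ 4 * c4 E == k%:Z ^+ 4 * c4 M) &&
  (n%:Z ^+ 3 * D%:Z ^+ 6 * c6 E == k%:Z ^+ 6 * c6 M).

(** If D is the absolute discriminant of a model that the twist reaches with the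
    scaling factor u, this is (|u| D)^12. *)
Definition scale_power (D : nat) : nat := (n ^ 6 * `|disc E| * D ^ 11)%N.

(** The search returns a value out of range if scale_power is not a twelfth power; the
    test of scale D ^ 12 in attained discards that case. *)
Definition scale (D : nat) : nat :=
  find (fun k => k ^ 12 == scale_power D)%N (iota 0 (scale_power D).+1).

(** If scaled_twist holds with some k > 0, then |c4 M| and |c6 M| are at most the two
    products below, and reduced_model_bound bounds a4 and a6; a code is at most
    twice the absolute value of what it encodes. *)
Definition code_bound (D : nat) : nat :=
  (200 * (1 + n ^ 2 * D ^ 4 * `|c4 E| + n ^ 3 * D ^ 6 * `|c6 E|)).+1.

(** When n > 0 and E is nonsingular, this decides whether D is the absolute
    discriminant of an integral model of the twist: see attained_sound,
    attained_complete and model_scale.  The codes 0, 1, 2 stand for 0, -1, 1. *)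
Definition attained (D : nat) : bool :=
  [&& 0 < D, scale D ^ 12 == scale_power D &
    has (fun i1 => has (fun i2 => has (fun i3 => has (fun i4 => has (fun i6 =>
      scaled_twist D (scale D)
        (Weierstrass (int_decode i1) (int_decode i2) (int_decode i3)
                     (int_decode i4) (int_decode i6)))
      (iota 0 (code_bound D))) (iota 0 (code_bound D)))
      (iota 0 3)) (iota 0 3)) (iota 0 3)]%N.

Definition least_disc : nat :=
  find attained (iota 0 (2 ^ 12 * n ^ 6 * `|disc E|).+1)%N.

Definition twist_factor : rat := (scale least_disc)%:R / least_disc%:R.

End Search.

Lemma int_decode_onto (z : int) : exists2 m, (m <= 2 * `|z|)%N & int_decode m = z.
Proof.
rewrite /int_decode; case: z => m.
  by exists (m.*2); rewrite ?odd_double ?doubleK //; lia.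
by exists (m.*2.+1); rewrite /= ?odd_double /= ?uphalf_double //; lia.
Qed.

Lemma absz_le_of_mul_eq (k a : nat) (x y : int) :
  (0 < k)%N -> a%:Z * x = k%:Z * y -> (`|y| <= a * `|x|)%N.
Proof.
move=> k0 /(congr1 absz); rewrite !abszM !absz_nat => ->.
by rewrite leq_pmull.
Qed.

Lemma scaleP (E : weierstrass int) (n D k : nat) :
  (k ^ 12)%N = scale_power E n D -> scale E n D = k.
Proof.
move=> hk; rewrite /scale.
have hP : has (fun k => k ^ 12 == scale_power E n D)%N (iota 0 (scale_power E n D).+1).
  apply/hasP; exists k; last exact/eqP.
  rewrite mem_iota /= add0n ltnS -hk; case: (k) => // m.
  by rewrite -[X in (X <= _)%N]expn1 leq_pexp2l.
have := nth_find 0%N hP; rewrite nth_iota ?add0n; last first.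
  by rewrite -[X in (_ < X)%N](size_iota 0) -has_find.
by rewrite -hk eqn_exp2r // => /eqP.
Qed.

(** Replacing M by a reduced model changes neither c4 nor c6, and puts the
    coefficients within the range of the search. *)
Lemma attained_complete (E : weierstrass int) (n D k : nat) (M : weierstrass int) :
  (0 < D)%N -> (0 < k)%N -> (k ^ 12)%N = scale_power E n D -> scaled_twist E n D k M ->
  attained E n D.
Proof.
rewrite /scaled_twist => D0 k0 hk.
have [N [[h1 h2 h3] [<- <-]]] := reduced_model M => /andP[/eqP e4 /eqP e6].
have [h4 h6] := reduced_model_bound h1 h2 h3.
rewrite /attained (scaleP hk); apply/and3P; split=> //; first exact/eqP.
have le4 : (`|c4 N| <= n ^ 2 * D ^ 4 * `|c4 E|)%N.
  by apply: (@absz_le_of_mul_eq (k ^ 4)); rewrite ?expn_gt0 ?k0 // PoszM -!rmorphXn.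
have le6 : (`|c6 N| <= n ^ 3 * D ^ 6 * `|c6 E|)%N.
  by apply: (@absz_le_of_mul_eq (k ^ 6)); rewrite ?expn_gt0 ?k0 // PoszM -!rmorphXn.
have small (z : int) (B : nat) : (2 * `|z| < B)%N ->
    exists2 m, m \in iota 0 B & int_decode m = z.
  move=> zB; have [m mz <-] := int_decode_onto z.
  by exists m => //; rewrite mem_iota /= add0n (leq_ltn_trans mz).
have [i1 m1 E1] := small (a1 N) 3%N ltac:(lia).
have [i2 m2 E2] := small (a2 N) 3%N ltac:(lia).
have [i3 m3 E3] := small (a3 N) 3%N ltac:(lia).
have [i4 m4 E4] := small (a4 N) (code_bound E n D) ltac:(rewrite /code_bound; lia).
have [i6 m6 E6] := small (a6 N) (code_bound E n D) ltac:(rewrite /code_bound; lia).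
apply/hasP; exists i1 => //; apply/hasP; exists i2 => //; apply/hasP; exists i3 => //.
apply/hasP; exists i4 => //; apply/hasP; exists i6 => //.
rewrite E1 E2 E3 E4 E6 (_ : Weierstrass _ _ _ _ _ = N); last by case: (N).
by rewrite /scaled_twist e4 e6 !eqxx.
Qed.

Lemma to_rat_c4 (M : weierstrass int) : c4 (to_rat M) = (c4 M)%:~R.
Proof. exact: c4_map. Qed.

Lemma to_rat_c6 (M : weierstrass int) : c6 (to_rat M) = (c6 M)%:~R.
Proof. exact: c6_map. Qed.

Lemma to_rat_disc (M : weierstrass int) : disc (to_rat M) = (disc M)%:~R.
Proof. exact: disc_map. Qed.

(** The equations between c4 and c6 make M isomorphic to the twist with u = k / D.
    Then k^12 |disc M| = n^6 |disc E| D^12, and k^12 = n^6 |disc E| D^11 is nonzero,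
    so that |disc M| = D. *)
Lemma attained_sound (E : weierstrass int) (n D : nat) :
  disc E != 0 -> (0 < n)%N -> attained E n D ->
  exists M, isomorphic (quadratic_twist n%:R (to_rat E)) (to_rat M) /\
    `|disc M|%N = D.
Proof.
move=> dE n0 /and3P[D0 /eqP hk].
set k := scale E n D in hk *.
case/hasP => i1 _ /hasP[i2 _ /hasP[i3 _ /hasP[i4 _ /hasP[i6 _ ]]]].
set M := Weierstrass _ _ _ _ _ => /andP[/eqP e4 /eqP e6].
have P0 : (0 < scale_power E n D)%N.
  by rewrite /scale_power 2!muln_gt0 !expn_gt0 n0 D0 absz_gt0 dE.
have k0 : (0 < k)%N by move: P0; rewrite -hk expn_gt0 orbF.
have D0' : (D%:R : rat) != 0 by rewrite pnatr_eq0 -lt0n.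
have k0' : (k%:R : rat) != 0 by rewrite pnatr_eq0 -lt0n.
have u0 : (k%:R / D%:R : rat) != 0 by rewrite mulf_neq0 ?invr_eq0.
have {}e4 := congr1 (intr : int -> rat) e4.
have {}e6 := congr1 (intr : int -> rat) e6.
have [||r [s [t eM]]] := @change_coords_of_c4_c6 _ _
  (quadratic_twist n%:R (to_rat E)) (to_rat M) u0.
- rewrite c4_quadratic_twist !to_rat_c4.
  move: e4; rewrite !(rmorphXn, rmorphM) /= -!pmulrn => e4.
  by rewrite expr_div_n [RHS]mulrAC -e4; field.
- rewrite c6_quadratic_twist !to_rat_c6.
  move: e6; rewrite !(rmorphXn, rmorphM) /= -!pmulrn => e6.
  by rewrite expr_div_n [RHS]mulrAC -e6; field.
exists M; split; first by exists (k%:R / D%:R), r, s, t.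
have := congr1 (@disc _) eM; rewrite disc_change_coords // disc_quadratic_twist.
rewrite !to_rat_disc => /(congr1 Num.norm).
rewrite normrM normfV normrM !normrX normf_div !normr_nat -!intr_norm -!abszE -!pmulrn => dM.
have {}hk := congr1 (fun m : nat => m%:R : rat) hk.
rewrite /scale_power !(natrX, natrM) in hk.
apply/eqP; rewrite -(eqr_nat rat); apply/eqP; rewrite [LHS]dM.
have dE' : (`|disc E|%N%:R : rat) != 0 by rewrite pnatr_eq0 absz_eq0.
have n0' : (n%:R : rat) != 0 by rewrite pnatr_eq0 -lt0n.
rewrite expr_div_n hk.
by field; rewrite D0' dE' n0'.
Qed.

(** The integers are integrally closed: for x = a / b in lowest terms, b^(e+1) divides
    a^(e+1), hence b divides a. *)
Lemma nat_of_rat_exp (x : rat) (m e : nat) :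
  0 <= x -> x ^+ e.+1 = m%:R -> exists k : nat, x = k%:R.
Proof.
case/ratP: x => a b cop.
have b0 : 0 < (b.+1%:~R : rat) by rewrite ltr0z.
rewrite pmulr_lge0 ?invr_gt0 // ler0z; case: a cop => // a cop _ hx.
have ab : (a ^ e.+1 = m * b.+1 ^ e.+1)%N.
  apply/eqP; rewrite -(eqr_nat rat); apply/eqP.
  by rewrite !(natrX, natrM) -hx expr_div_n -!pmulrn divfK // expf_neq0 // pnatr_eq0.
have : (b.+1 %| a)%N by rewrite -(@dvdn_pexp2r _ _ e.+1) // ab dvdn_mull.
move/gcdn_idPl => ba; move: cop; rewrite /coprime gcdnC [gcdn _ _]ba => /eqP -> .
by exists a; rewrite divr1.
Qed.

(** The discriminant equation u^12 disc M = n^6 disc E makes |u| |disc M| a rational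
    number whose twelfth power is integral. *)
Lemma model_scale (E M : weierstrass int) (n : nat) (u r s t : rat) :
  disc E != 0 -> (0 < n)%N -> u != 0 ->
  to_rat M = change_coords u r s t (quadratic_twist n%:R (to_rat E)) ->
  exists k : nat, [/\ (0 < `|disc M|)%N, (0 < k)%N, k%:R = `|u| * `|disc M|%:R :> rat,
    (k ^ 12)%N = scale_power E n `|disc M| & scaled_twist E n `|disc M| k M].
Proof.
move=> dE n0 u0 eM.
have n0' : (n%:R : rat) != 0 by rewrite pnatr_eq0 -lt0n.
have dM := congr1 (@disc _) eM; have e4 := congr1 (@c4 _) eM; have e6 := congr1 (@c6 _) eM.
rewrite disc_change_coords // disc_quadratic_twist !to_rat_disc in dM.
rewrite c4_change_coords // c4_quadratic_twist !to_rat_c4 in e4.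
rewrite c6_change_coords // c6_quadratic_twist !to_rat_c6 in e6.
have D0 : (0 < `|disc M|)%N.
  rewrite absz_gt0 -(intr_eq0 rat) dM.
  by rewrite !mulf_neq0 ?invr_eq0 ?expf_neq0 ?intr_eq0.
set D := `|disc M|%N in D0 *.
have hD : (D%:R : rat) * `|u| ^+ 12 = n%:R ^+ 6 * `|disc E|%:R.
  rewrite /D !natr_absz !intr_norm dM normf_div !(normrX, normrM) normr_nat.
  by field; rewrite normr_eq0.
have hx : (`|u| * D%:R) ^+ 12 = (scale_power E n D)%:R :> rat.
  rewrite /scale_power !(natrX, natrM) -hD; ring.
have [k hk] := nat_of_rat_exp (mulr_ge0 (normr_ge0 u) (ler0n _ D)) hx.
have even_norm m : `|u| ^+ m.*2 = u ^+ m.*2.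
  by rewrite -muln2 mulnC !exprM real_normK ?num_real.
exists k; split=> //.
- by rewrite -(ltr_nat rat) -hk mulr_gt0 ?normr_gt0 // ltr0n.
- by apply/eqP; rewrite -(eqr_nat rat) natrX -hk hx.
apply/andP; split; apply/eqP; apply: (@intr_inj rat);
  rewrite !(rmorphXn, rmorphM) /= -!pmulrn -hk [in RHS]exprMn.
- by rewrite (even_norm 2%N) e4; field.
- by rewrite (even_norm 3%N) e6; field.
Qed.

(** The substitution with u = 1/2 clears the denominators of the twist.  The
    resulting model bounds the search for the least discriminant. *)
Lemma integral_twist_model (E : weierstrass int) (n : nat) :
  exists M : weierstrass int,
    isomorphic (quadratic_twist n%:R (to_rat E)) (to_rat M) /\
    `|disc M|%N = (2 ^ 12 * n ^ 6 * `|disc E|)%N.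
Proof.
pose M := Weierstrass 0 (n%:Z * b2 E) 0 (8 * n%:Z ^+ 2 * b4 E) (16 * n%:Z ^+ 3 * b6 E).
exists M; split.
  exists (2^-1), 0, 0, 0; split; first by rewrite invr_eq0.
  rewrite /M /to_rat /map_weierstrass /change_coords /quadratic_twist /b2 /b4 /b6 /=.
  by congr Weierstrass; field.
have -> : disc M = 2 ^+ 12 * n%:Z ^+ 6 * disc E.
  by rewrite /disc /b2 /b4 /b6 /b8 /=; rewrite /b2 /b4 /b6; ring.
by rewrite !(abszX, abszM).
Qed.

(** Both inequalities between least_disc E n and |disc En|: En is a candidate of the
    search, and what the search finds is realised by an integral model of the twist,
    to which the minimality of En applies. *)
Lemma twist_factorE (E En : weierstrass int) (n : nat) (u r s t : rat) :
  disc E != 0 -> (0 < n)%N -> u != 0 ->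
  to_rat En = change_coords u r s t (quadratic_twist n%:R (to_rat E)) ->
  (forall M, isomorphic (quadratic_twist n%:R (to_rat E)) (to_rat M) ->
     `|disc En| <= `|disc M|) ->
  twist_factor E n = `|u|.
Proof.
move=> dE n0 u0 eEn minEn.
have [k [D0 k0 kE hk sk]] := model_scale dE n0 u0 eEn.
have attEn := attained_complete D0 k0 hk sk.
have [M2 [iso2 disc2]] := integral_twist_model E n.
have leB : (`|disc En| < (2 ^ 12 * n ^ 6 * `|disc E|).+1)%N.
  by rewrite ltnS -disc2 -lez_nat !abszE minEn.
suff -> : twist_factor E n = k%:R / `|disc En|%:R.
  by rewrite kE mulfK // pnatr_eq0 -lt0n.
suff eD : least_disc E n = `|disc En|%N by rewrite /twist_factor eD (scaleP hk).
set B := (2 ^ 12 * n ^ 6 * `|disc E|).+1 in leB.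
have hasB : has (attained E n) (iota 0 B).
  by apply/hasP; exists `|disc En|%N; rewrite // mem_iota.
have ltB : (least_disc E n < B)%N by rewrite -[B](size_iota 0) -has_find.
have := nth_find 0%N hasB; rewrite nth_iota // add0n.
case/(attained_sound dE n0) => M [isoM discM].
apply/eqP; rewrite eqn_leq; apply/andP; split.
  rewrite leqNgt; apply/negP => lt; have := before_find 0%N lt.
  by rewrite nth_iota // add0n attEn.
by rewrite -[X in (_ <= X)%N]discM -lez_nat !abszE minEn.
Qed.

(** * Closure properties of the recursive functions *)

Lemma eq_recursive k (f g : k.-tuple nat -> nat) : recursive f -> f =1 g -> recursive g.
Proof. by move=> + /funext <-. Qed.

(** Changes of the list of arguments.  The body of a bounded search has one more
    argument than the search itself, so a function that it uses is composed with
    such a change. *)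
Definition recursive_env k m (e : k.-tuple nat -> m.-tuple nat) : Prop :=
  forall i, recursive (fun v => tnth (e v) i).

Lemma recursive_at k m (f : m.-tuple nat -> nat) (e : k.-tuple nat -> m.-tuple nat) :
  recursive f -> recursive_env e -> recursive (fun v => f (e v)).
Proof.
move=> rf re; apply: (eq_recursive (recursive_comp rf re)) => v.
by congr f; apply: eq_from_tnth => i; rewrite tnth_mktuple.
Qed.

Lemma recursive_env_id k : recursive_env (fun v : k.-tuple nat => v).
Proof. exact: recursive_proj. Qed.

Lemma recursive_env_behead k m (e : k.-tuple nat -> m.+1.-tuple nat) :
  recursive_env e -> recursive_env (fun v => [tuple of behead (e v)] : m.-tuple nat).
Proof.
move=> re i; apply: (eq_recursive (re (lift ord0 i))) => v.
by rewrite tnth_behead; congr tnth; apply: val_inj; rewrite /= inordK ?ltnS.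
Qed.

Lemma recursive_thead k m (e : k.-tuple nat -> m.+1.-tuple nat) :
  recursive_env e -> recursive (fun v => thead (e v)).
Proof. by move=> re; exact: re. Qed.

Lemma recursive_comp1 k (op : nat -> nat) (f : k.-tuple nat -> nat) :
  recursive (fun w : 1.-tuple nat => op (thead w)) -> recursive f ->
  recursive (fun v => op (f v)).
Proof.
move=> rop rf; apply: (eq_recursive (@recursive_comp k 1 _ (fun=> f) rop _)) => // v.
by rewrite /thead tnth_mktuple.
Qed.

Lemma recursive_comp2 k (op : nat -> nat -> nat) (f g : k.-tuple nat -> nat) :
  recursive (fun w : 2.-tuple nat => op (thead w) (tnth w ord_max)) ->
  recursive f -> recursive g -> recursive (fun v => op (f v) (g v)).
Proof.
move=> rop rf rg.
apply: (eq_recursive (@recursive_comp k 2 _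
  (fun i => if i == ord0 then f else g) rop _)) => [i|v].
  by case: ifP.
by rewrite /thead !tnth_mktuple.
Qed.

Lemma recursive_const k c : recursive (fun _ : k.-tuple nat => c).
Proof.
have r0 : recursive (fun _ : k.-tuple nat => 0%N).
  apply: (eq_recursive (@recursive_comp k 0 _ (fun i _ => 0%N) recursive_zero _)) => //.
  by case.
by elim: c => // c /(recursive_comp1 recursive_succ).
Qed.

Lemma recursive_S k (f : k.-tuple nat -> nat) :
  recursive f -> recursive (fun v => (f v).+1).
Proof. exact: (recursive_comp1 recursive_succ). Qed.

(** Primitive recursion without parameters, where the step may use the counter m. *)
Lemma recursive_iteration (op : nat -> nat) (a : nat) (step : nat -> nat -> nat) :
  op 0%N = a -> (forall m, op m.+1 = step m (op m)) ->
  recursive (fun w : 2.-tuple nat => step (thead w) (tnth w ord_max)) ->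
  forall k (f : k.-tuple nat -> nat), recursive f -> recursive (fun v => op (f v)).
Proof.
move=> op0 opS rs k f; apply: recursive_comp1.
apply: (recursive_primrec (recursive_const 0 a) rs) => [v|m v].
  by rewrite theadE.
by rewrite !theadE opS; congr step.
Qed.

(** Primitive recursion on the first argument with the second one as a parameter; the
    step does not see the counter, which is enough for sums, products and
    differences. *)
Lemma recursive_iteration2 (op : nat -> nat -> nat) (step : nat -> nat -> nat) :
  recursive (fun w : 1.-tuple nat => op 0%N (thead w)) ->
  (forall m p, op m.+1 p = step (op m p) p) ->
  recursive (fun w : 2.-tuple nat => step (thead w) (tnth w ord_max)) ->
  forall k (f g : k.-tuple nat -> nat),
  recursive f -> recursive g -> recursive (fun v => op (f v) (g v)).
Proof.
move=> r0 opS rs k f g; apply: recursive_comp2.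
have rg : recursive (fun w : 3.-tuple nat =>
    step (tnth w (inord 1)) (tnth w (inord 2))).
  by apply: recursive_comp2 rs _ _; exact: recursive_proj.
apply: (recursive_primrec r0 rg) => [v|m v].
  by rewrite !theadE (tnth_nth 0%N) [in RHS]/thead (tnth_nth 0%N).
by rewrite !theadE opS; congr step; rewrite !(tnth_nth 0%N) /= inordK.
Qed.

Lemma recursive_add k (f g : k.-tuple nat -> nat) :
  recursive f -> recursive g -> recursive (fun v => (f v + g v)%N).
Proof.
apply: (@recursive_iteration2 addn (fun s _ => s.+1)) => //.
- exact: recursive_proj.
- by apply: recursive_S; exact: recursive_proj.
Qed.

Lemma recursive_mul k (f g : k.-tuple nat -> nat) :
  recursive f -> recursive g -> recursive (fun v => (f v * g v)%N).
Proof.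
apply: (@recursive_iteration2 muln (fun s p => (p + s)%N)) => //.
- exact: recursive_const.
- by apply: recursive_add; exact: recursive_proj.
Qed.

Lemma recursive_exp k (f : k.-tuple nat -> nat) c :
  recursive f -> recursive (fun v => (f v ^ c)%N).
Proof.
move=> rf; elim: c => [|c IH]; first exact: recursive_const.
by under eq_fun do rewrite expnS; exact: recursive_mul.
Qed.

Lemma recursive_pred k (f : k.-tuple nat -> nat) :
  recursive f -> recursive (fun v => (f v).-1).
Proof.
by apply: (@recursive_iteration predn 0%N (fun m _ => m)) => //; exact: recursive_proj.
Qed.

Lemma recursive_sub k (f g : k.-tuple nat -> nat) :
  recursive f -> recursive g -> recursive (fun v => (f v - g v)%N).
Proof.
move=> rf rg.
apply: (@recursive_iteration2 (fun m p => (p - m)%N) (fun s _ => s.-1)) rg rf => //=.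
- by under eq_fun do rewrite subn0; exact: recursive_proj.
- by move=> m p; rewrite subnS.
- by apply: recursive_pred; exact: recursive_proj.
Qed.

Lemma recursive_odd k (f : k.-tuple nat -> nat) :
  recursive f -> recursive (fun v => odd (f v) : nat).
Proof.
apply: (@recursive_iteration odd 0%N (fun _ b => 1 - b)%N) => //= [m|].
  by case: (odd m).
by apply: recursive_sub; [exact: recursive_const | exact: recursive_proj].
Qed.

Lemma recursive_half k (f : k.-tuple nat -> nat) :
  recursive f -> recursive (fun v => (f v)./2).
Proof.
apply: (@recursive_iteration half 0%N (fun m h => odd m + h)%N) => //= [m|].
  by rewrite uphalf_half.
by apply: recursive_add; [apply: recursive_odd|]; exact: recursive_proj.
Qed.

Definition recursive_bool k (P : k.-tuple nat -> bool) := recursive (fun v => P v : nat).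

Lemma recursive_leq k (f g : k.-tuple nat -> nat) :
  recursive f -> recursive g -> recursive_bool (fun v => (f v <= g v)%N).
Proof.
move=> rf rg; apply: (@eq_recursive _ (fun v => 1 - (f v - g v))%N) => [|v].
  by apply: recursive_sub; [exact: recursive_const | exact: recursive_sub].
by rewrite -subn_eq0; case: (f v - g v)%N => // m; rewrite subSS sub0n.
Qed.

Lemma recursive_negb k (P : k.-tuple nat -> bool) :
  recursive_bool P -> recursive_bool (fun v => ~~ P v).
Proof.
move=> rP; apply: (@eq_recursive _ (fun v => 1 - P v)%N) => [|v].
  by apply: recursive_sub => //; exact: recursive_const.
by case: (P v).
Qed.

Lemma recursive_andb k (P Q : k.-tuple nat -> bool) :
  recursive_bool P -> recursive_bool Q -> recursive_bool (fun v => P v && Q v).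
Proof.
move=> rP rQ; apply: (eq_recursive (recursive_mul rP rQ)) => v.
by case: (P v); case: (Q v).
Qed.

Lemma recursive_eqn k (f g : k.-tuple nat -> nat) :
  recursive f -> recursive g -> recursive_bool (fun v => f v == g v).
Proof.
move=> rf rg; under eq_fun do rewrite eqn_leq.
by apply: recursive_andb; apply: recursive_leq.
Qed.

(** Minimization applied to a test that also succeeds at B v, which makes it total;
    find returns the length B v of the list when P fails everywhere. *)
Lemma recursive_find k (P : nat -> k.-tuple nat -> bool) (B : k.-tuple nat -> nat) :
  recursive_bool (fun w : k.+1.-tuple nat => P (thead w) [tuple of behead w]) ->
  recursive B -> recursive (fun v => find (P^~ v) (iota 0 (B v))).
Proof.
move=> rP rB.
pose Q (w : k.+1.-tuple nat) :=
  ~~ P (thead w) [tuple of behead w] && (thead w < B [tuple of behead w])%N.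
have consK m (v : k.-tuple nat) : [tuple of behead [tuple of m :: v]] = v.
  exact: val_inj.
have rQ : recursive_bool Q.
  apply: recursive_andb; first exact: recursive_negb.
  apply: recursive_leq.
    by apply: recursive_S; exact: recursive_proj.
  by apply: recursive_at rB _; apply: recursive_env_behead; exact: recursive_env_id.
apply: (recursive_min rQ) => [v|v m mh]; rewrite /Q theadE consK.
  have [hP|] := boolP (has (P^~ v) (iota 0 (B v))).
    have := nth_find 0%N hP; rewrite nth_iota ?add0n => [->//|].
    by rewrite -[X in (_ < X)%N](size_iota 0) -has_find.
  by move/hasNfind => ->; rewrite size_iota ltnn andbF.
have mB : (m < B v)%N.
  by rewrite (leq_trans mh) // -[X in (_ <= X)%N](size_iota 0) find_size.
by have := before_find 0%N mh; rewrite nth_iota // add0n mB => ->.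
Qed.

Lemma recursive_has k (P : nat -> k.-tuple nat -> bool) (B : k.-tuple nat -> nat) :
  recursive_bool (fun w : k.+1.-tuple nat => P (thead w) [tuple of behead w]) ->
  recursive B -> recursive_bool (fun v => has (P^~ v) (iota 0 (B v))).
Proof.
move=> rP rB; under eq_fun do rewrite has_find size_iota.
by apply: recursive_leq => //; apply: recursive_S; exact: recursive_find.
Qed.

(** Integer-valued functions are handled as differences of two recursive functions,
    a form preserved by the ring operations without any case analysis on signs. *)
Definition recursive_int k (f : k.-tuple nat -> int) : Prop :=
  exists p q : k.-tuple nat -> nat,
    [/\ recursive p, recursive q & f = (fun v => (p v)%:Z - (q v)%:Z)].

Lemma recursive_int_const k (z : int) : recursive_int (fun _ : k.-tuple nat => z).
Proof.
case: z => c; [exists (fun=> c), (fun=> 0%N) | exists (fun=> 0%N), (fun=> c.+1)];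
  split; try exact: recursive_const; apply/funext => v; lia.
Qed.

Lemma recursive_Posz k (f : k.-tuple nat -> nat) :
  recursive f -> recursive_int (fun v => (f v)%:Z).
Proof.
move=> rf; exists f, (fun=> 0%N); split=> //; first exact: recursive_const.
by apply/funext => v; rewrite subr0.
Qed.

Lemma recursive_int_add k (f g : k.-tuple nat -> int) :
  recursive_int f -> recursive_int g -> recursive_int (fun v => f v + g v).
Proof.
move=> [p [q [rp rq ->]]] [p' [q' [rp' rq' ->]]].
exists (fun v => p v + p' v)%N, (fun v => q v + q' v)%N.
split; try exact: recursive_add.
by apply/funext => v; rewrite !PoszD; ring.
Qed.

Lemma recursive_int_opp k (f : k.-tuple nat -> int) :
  recursive_int f -> recursive_int (fun v => - f v).
Proof.
move=> [p [q [rp rq ->]]]; exists q, p; split=> //.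
by apply/funext => v; rewrite opprB.
Qed.

Lemma recursive_int_mul k (f g : k.-tuple nat -> int) :
  recursive_int f -> recursive_int g -> recursive_int (fun v => f v * g v).
Proof.
move=> [p [q [rp rq ->]]] [p' [q' [rp' rq' ->]]].
exists (fun v => p v * p' v + q v * q' v)%N, (fun v => p v * q' v + q v * p' v)%N.
split; try by apply: recursive_add; exact: recursive_mul.
by apply/funext => v; rewrite !PoszD !PoszM; ring.
Qed.

Lemma recursive_int_exp k (f : k.-tuple nat -> int) c :
  recursive_int f -> recursive_int (fun v => f v ^+ c).
Proof.
move=> rf; elim: c => [|c IH].
  by under eq_fun do rewrite expr0; exact: recursive_int_const.
by under eq_fun do rewrite exprS; exact: recursive_int_mul.
Qed.

Lemma recursive_absz k (f : k.-tuple nat -> int) :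
  recursive_int f -> recursive (fun v => `|f v|%N).
Proof.
move=> [p [q [rp rq ->]]].
apply: (@eq_recursive _ (fun v => (p v - q v) + (q v - p v))%N) => [|v]; last lia.
by apply: recursive_add; exact: recursive_sub.
Qed.

Lemma recursive_eqz k (f g : k.-tuple nat -> int) :
  recursive_int f -> recursive_int g -> recursive_bool (fun v => f v == g v).
Proof.
move=> rf rg; under eq_fun do rewrite -subr_eq0 -absz_eq0.
apply: recursive_eqn; last exact: recursive_const.
by apply: recursive_absz; apply: recursive_int_add => //; exact: recursive_int_opp.
Qed.

Lemma recursive_int_decode k (f : k.-tuple nat -> nat) :
  recursive f -> recursive_int (fun v => int_decode (f v)).
Proof.
move=> rf; exists (fun v => (1 - odd (f v)) * (f v)./2)%N,
                  (fun v => odd (f v) * (f v)./2.+1)%N.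
split; last by apply/funext => v; rewrite /int_decode; case: (odd (f v)); lia.
- apply: recursive_mul (recursive_half rf).
  by apply: recursive_sub (recursive_odd rf); exact: recursive_const.
- exact: recursive_mul (recursive_odd rf) (recursive_S (recursive_half rf)).
Qed.

(** * Recursiveness of the scaling factor *)

Definition recursive_model k (E : k.-tuple nat -> weierstrass int) : Prop :=
  [/\ recursive_int (fun v => a1 (E v)), recursive_int (fun v => a2 (E v)),
      recursive_int (fun v => a3 (E v)), recursive_int (fun v => a4 (E v)) &
      recursive_int (fun v => a6 (E v))].

Lemma recursive_int_at k m (f : m.-tuple nat -> int) (e : k.-tuple nat -> m.-tuple nat) :
  recursive_int f -> recursive_env e -> recursive_int (fun v => f (e v)).
Proof.
move=> [p [q [rp rq ->]]] re; exists (fun v => p (e v)), (fun v => q (e v)).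
by split=> //; exact: recursive_at.
Qed.

Lemma recursive_model_at k m (E : m.-tuple nat -> weierstrass int)
    (e : k.-tuple nat -> m.-tuple nat) :
  recursive_model E -> recursive_env e -> recursive_model (fun v => E (e v)).
Proof.
move=> [r1 r2 r3 r4 r6] re.
split; [exact: recursive_int_at r1 re | exact: recursive_int_at r2 re
  | exact: recursive_int_at r3 re | exact: recursive_int_at r4 re
  | exact: recursive_int_at r6 re].
Qed.

Ltac recursive_int_tac :=
  repeat first [ assumption | exact: recursive_int_const
    | apply: recursive_int_exp | apply: recursive_int_mul
    | apply: recursive_int_opp | apply: recursive_int_add | apply: recursive_Posz ].

Lemma recursive_c4 k (E : k.-tuple nat -> weierstrass int) :
  recursive_model E -> recursive_int (fun v => c4 (E v)).
Proof. by move=> [r1 r2 r3 r4 r6]; rewrite /c4 /b2 /b4; recursive_int_tac. Qed.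

Lemma recursive_c6 k (E : k.-tuple nat -> weierstrass int) :
  recursive_model E -> recursive_int (fun v => c6 (E v)).
Proof. by move=> [r1 r2 r3 r4 r6]; rewrite /c6 /b2 /b4 /b6; recursive_int_tac. Qed.

Lemma recursive_disc k (E : k.-tuple nat -> weierstrass int) :
  recursive_model E -> recursive_int (fun v => disc (E v)).
Proof.
by move=> [r1 r2 r3 r4 r6]; rewrite /disc /b2 /b4 /b6 /b8; recursive_int_tac.
Qed.

Ltac recursive_nat_tac :=
  repeat first [ assumption | exact: recursive_const | apply: recursive_exp
    | apply: recursive_mul | apply: recursive_add | apply: recursive_S
    | apply: recursive_absz | exact: recursive_c4 | exact: recursive_c6
    | exact: recursive_disc].

Section RecursiveSearch.
Variables (k : nat) (E : k.-tuple nat -> weierstrass int) (n : k.-tuple nat -> nat).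
Hypotheses (rE : recursive_model E) (rn : recursive n).

Lemma recursive_scale (D : k.-tuple nat -> nat) :
  recursive D -> recursive (fun v => scale (E v) (n v) (D v)).
Proof.
move=> rD.
have rP : recursive (fun v => scale_power (E v) (n v) (D v)).
  by rewrite /scale_power; recursive_nat_tac.
apply: (recursive_find (P := fun m v => m ^ 12 == scale_power (E v) (n v) (D v))%N).
  apply: recursive_eqn.
    by apply: recursive_exp; apply: recursive_thead; exact: recursive_env_id.
  by apply: (recursive_at rP); apply: recursive_env_behead; exact: recursive_env_id.
exact: recursive_S.
Qed.

Lemma recursive_scaled_twist (D m : k.-tuple nat -> nat) (M : k.-tuple nat -> weierstrass int) :
  recursive D -> recursive m -> recursive_model M ->
  recursive_bool (fun v => scaled_twist (E v) (n v) (D v) (m v) (M v)).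
Proof.
move=> rD rm rM; have := recursive_c4 rE; have := recursive_c6 rE.
have := recursive_c4 rM; have := recursive_c6 rM => ? ? ? ?.
by apply: recursive_andb; apply: recursive_eqz; recursive_int_tac.
Qed.

End RecursiveSearch.

Ltac recursive_env_tac :=
  repeat apply: recursive_env_behead; exact: recursive_env_id.

Lemma recursive_attained k (E : k.-tuple nat -> weierstrass int) (n D : k.-tuple nat -> nat) :
  recursive_model E -> recursive n -> recursive D ->
  recursive_bool (fun v => attained (E v) (n v) (D v)).
Proof.
move=> rE rn rD; have rs := recursive_scale rE rn rD.
have rB : recursive (fun v => code_bound (E v) (n v) (D v)).
  by rewrite /code_bound; recursive_nat_tac.
apply: recursive_andb; first exact: recursive_leq (recursive_const _ _) rD.
apply: recursive_andb.
  by apply: recursive_eqn; rewrite /scale_power; recursive_nat_tac.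
do 3![apply: recursive_has; last exact: recursive_const].
apply: recursive_has; last by apply: (recursive_at rB); recursive_env_tac.
apply: recursive_has; last by apply: (recursive_at rB); recursive_env_tac.
apply: recursive_scaled_twist.
- by apply: (recursive_model_at rE); recursive_env_tac.
- by apply: (recursive_at rn); recursive_env_tac.
- by apply: (recursive_at rD); recursive_env_tac.
- by apply: (recursive_at rs); recursive_env_tac.
by split; apply: recursive_int_decode; apply: recursive_thead; recursive_env_tac.
Qed.

Lemma recursive_least_disc k (E : k.-tuple nat -> weierstrass int) (n : k.-tuple nat -> nat) :
  recursive_model E -> recursive n ->
  recursive (fun v => least_disc (E v) (n v)).
Proof.
move=> rE rn; apply: (recursive_find (P := fun D v => attained (E v) (n v) D)).
  apply: recursive_attained.
  - by apply: (recursive_model_at rE); recursive_env_tac.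
  - by apply: (recursive_at rn); recursive_env_tac.
  - by apply: recursive_thead; recursive_env_tac.
by recursive_nat_tac.
Qed.

Lemma computable_twist_factor : computable twist_factor.
Proof.
pose E (v : 6.-tuple nat) := Weierstrass
  (int_decode (tnth v (inord 0))) (int_decode (tnth v (inord 1)))
  (int_decode (tnth v (inord 2))) (int_decode (tnth v (inord 3)))
  (int_decode (tnth v (inord 4))).
pose n (v : 6.-tuple nat) := tnth v (inord 5).
have rE : recursive_model E.
  by split; apply: recursive_int_decode; exact: recursive_proj.
have rn : recursive n by exact: recursive_proj.
have rD := recursive_least_disc rE rn.
have rs := recursive_scale rE rn rD.
(* The code of a nonnegative integer under int_decode is its double. *)
exists (fun v => scale (E v) (n v) (least_disc (E v) (n v)) +
   scale (E v) (n v) (least_disc (E v) (n v)))%N, (fun v => least_disc (E v) (n v)).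
split=> // [|c1 c2 c3 c4 c6 m W v]; first exact: recursive_add.
have -> : E v = W by rewrite /E /W !(tnth_nth 0%N) /= !inordK.
have -> : n v = m by rewrite /n (tnth_nth 0%N) /= inordK.
by rewrite /int_decode addnn odd_double doubleK.
Qed.

(** * The period of the minimal model of a twist *)

Lemma map_change_coords (K L : fieldType) (f : {rmorphism K -> L}) (u r s t : K)
    (W : weierstrass K) :
  map_weierstrass f (change_coords u r s t W) =
  change_coords (f u) (f r) (f s) (f t) (map_weierstrass f W).
Proof.
by congr Weierstrass; rewrite /= fmorph_div ?rmorphXn; congr (_ / _); ring.
Qed.

(** Completing the square is the substitution with s = - a1 / 2 and t = - a3 / 2, and
    twisting by n becomes the scaling by 1 / sqrt n once n has a square root. *)
Lemma quadratic_twist_real (R : realType) (E : weierstrass int) (n : nat) :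
  (0 < n)%N ->
  map_weierstrass (@ratr R) (quadratic_twist n%:R (to_rat E)) =
  change_coords (Num.sqrt n%:R)^-1 0 (- (a1 E)%:~R / 2) (- (a3 E)%:~R / 2)
    (map_weierstrass intr E).
Proof.
move=> n0; set q : R := Num.sqrt n%:R.
have q0 : q != 0 by rewrite sqrtr_eq0 -ltNge ltr0n.
have nE : n%:R = q ^+ 2 :> R by rewrite sqr_sqrtr // ler0n.
rewrite /quadratic_twist /change_coords /map_weierstrass /b2 /b4 /b6 /=.
rewrite !(rmorph0, rmorph_nat, rmorph_int, rmorphXn, fmorphV, rmorphM, rmorphD) /= nE.
by congr Weierstrass; field.
Qed.

Theorem lemma6p1 (R : realType) :
  exists alpha : weierstrass int -> nat -> rat,
    computable alpha /\
    forall (E : weierstrass int) (n : nat) (En : weierstrass int),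
      elliptic E -> minimal E ->
      (0 < n)%N -> square_free n ->
      minimal_model_of (quadratic_twist n%:R (to_rat E)) En ->
      alpha E n != 0 /\
      period R En = ((ratr (alpha E n) / Num.sqrt n%:R)%:E * period R E)%E.
Proof.
exists twist_factor; split; first exact: computable_twist_factor.
move=> E n En dE _ n0 _ [[u [r [s [t [u0 eEn]]]]] minEn].
have abs_min M : isomorphic (quadratic_twist n%:R (to_rat E)) (to_rat M) ->
    `|disc En| <= `|disc M| := @minEn M.
rewrite (twist_factorE dE n0 u0 eEn abs_min) normr_eq0 u0; split=> //.
have real_En : map_weierstrass intr En = map_weierstrass (@ratr R) (to_rat En).
  by rewrite /to_rat /map_weierstrass /= !ratr_int.
have q0 : (Num.sqrt n%:R)^-1 != 0 :> R.
  by rewrite invr_eq0 sqrtr_eq0 -ltNge ltr0n.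
rewrite -[period R En]/(real_period (map_weierstrass intr En)).
rewrite -[period R E]/(real_period (map_weierstrass intr E)).
rewrite real_En eEn map_change_coords quadratic_twist_real //.
rewrite real_period_change_coords ?fmorph_eq0 // real_period_change_coords //.
by rewrite muleA -EFinM -ratr_norm [`|_^-1|]ger0_norm ?invr_ge0.
Qed.
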